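(* Let $\mathcal{I}$ be a density ideal on $\omega$. Then the Boolean algebra $\mathcal{A}_{\mathcal{I}^*}=\mathcal{I}\cup\mathcal{I}^*$ has the Nikodym property if and only if $\mathcal{I}$ is isomorphic to an Erdős–Ulam ideal.
   Context: A density submeasure on $\omega$ is $\varphi=\sup_n\mu_n$ where $(\mu_n)$ are finitely supported non-negative measures on $\omega$ with pairwise disjoint supports; a density ideal is $\mathrm{exh}(\varphi)=\{A\subseteq\omega\colon\lim_n\varphi(A\setminus[0,n])=0\}$ for such $\varphi$. $f\colon\omega\to(0,\infty)$ is an Erdős–Ulam function if $\sum_n f(n)=\infty$ and $f(n)/\sum_{i\le n}f(i)\to0$; the associated Erdős–Ulam ideal is $\{A\subseteq\omega\colon\lim_n\sum_{i\in A\cap[0,n)}f(i)/\sum_{i<n}f(i)=0\}$. Ideals $\mathcal{I},\mathcal{J}$ are isomorphic if some bijection $g\colon\omega\to\omega$ satisfies $A\in\mathcal{I}\iff g[A]\in\mathcal{J}$. $\mathcal{I}^*=\{\omega\setminus A\colon A\in\mathcal{I}\}$. A Boolean algebra has the Nikodym property if every sequence of bounded finitely additive real functions on it converging to $0$ at every element is bounded in the variation norm $\|\mu\|=\sup\{|\mu(A)|+|\mu(B)|\colon A\wedge B=0\}$.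
   Formalization: The density ideal is assumed proper (ω ∉ I), as is usual for ideals on ω; for φ = 0 the ideal exh(φ) is all of P(ω), which has the Nikodym property but is not isomorphic to any Erdős–Ulam ideal. *)

(* Defs.v *)
From HB Require Import structures.
From mathcomp Require Import all_boot all_order all_algebra.
From mathcomp Require Import all_classical all_reals all_analysis.

Set Implicit Arguments.
Unset Strict Implicit.
Unset Printing Implicit Defensive.

Import Order.TTheory GRing.Theory Num.Theory.
Import numFieldNormedType.Exports.
Local Open Scope classical_set_scope.
Local Open Scope ring_scope.

Definition msupport (R : realType) (mu : set nat -> \bar R) : set nat :=
  [set k | mu [set k] != 0%E].

Definition density_submeasure (R : realType) (phi : set nat -> \bar R) : Prop :=
  exists mu : nat -> {finite_measure set nat -> \bar R},
    [/\ forall n, finite_set (msupport (mu n)),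
        trivIset setT (fun n => msupport (mu n)) &
        phi = fun A => ereal_sup (range (fun n => mu n A))].

(* [`I_n.+1] is the closed initial segment [0, n]. *)
Definition exh (R : realType) (phi : set nat -> \bar R) : set (set nat) :=
  [set A | phi (A `\` `I_n.+1) @[n --> \oo] --> 0%E].

(* An ideal on omega is proper by convention, whereas [exh phi] may be the    *)
(* whole power set; hence the last conjunct. The other ideal axioms, and the  *)
(* inclusion of the finite sets, are automatic for [exh phi].                 *)
Definition density_ideal (R : realType) (I : set (set nat)) : Prop :=
  exists phi : set nat -> \bar R,
    [/\ density_submeasure phi, I = exh phi & ~ I setT].

Definition erdos_ulam_fun (R : realType) (f : nat -> R) : Prop :=
  [/\ forall n, 0 < f n,
      (\sum_(0 <= i < n) f i) @[n --> \oo] --> +oo &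
      (f n / \sum_(0 <= i < n.+1) f i) @[n --> \oo] --> 0].

Definition erdos_ulam_ideal (R : realType) (f : nat -> R) : set (set nat) :=
  [set A | ((\sum_(0 <= i < n | i \in A) f i) / (\sum_(0 <= i < n) f i))
             @[n --> \oo] --> 0].

Definition ideal_isomorphic (I J : set (set nat)) : Prop :=
  exists2 g : nat -> nat, bijective g & forall A, I A <-> J (g @` A).

Definition dual_filter (I : set (set nat)) : set (set nat) :=
  [set ~` A | A in I].

(* Below, a Boolean algebra is given as an algebra [B] of subsets of [T], and *)
(* a function on [B] as a function on [set T] whose values outside [B] are    *)
(* never used.                                                                *)
Definition finitely_additive (R : realType) (T : Type) (B : set (set T))
    (mu : set T -> R) : Prop :=
  forall X Y, B X -> B Y -> X `&` Y = set0 -> mu (X `|` Y) = mu X + mu Y.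

Definition bounded_on (R : realType) (T : Type) (B : set (set T))
    (mu : set T -> R) : Prop :=
  exists M : R, forall X, B X -> `|mu X| <= M.

Definition variation_norm (R : realType) (T : Type) (B : set (set T))
    (mu : set T -> R) : \bar R :=
  ereal_sup [set z | exists X Y,
    [/\ B X, B Y, X `&` Y = set0 & z = (`|mu X| + `|mu Y|)%:E]].

Definition nikodym (R : realType) (T : Type) (B : set (set T)) : Prop :=
  forall mu : nat -> set T -> R,
    (forall n, finitely_additive B (mu n)) ->
    (forall n, bounded_on B (mu n)) ->
    (forall X, B X -> mu n X @[n --> \oo] --> 0) ->
    exists M : R, forall n, (variation_norm B (mu n) <= M%:E)%E.

(* Main.v *)
(** Write [W_n] for the measures defining a density ideal [I]; since their      *)
(** supports are finite and disjoint, [A] is in [I] iff [W_n(A)] tends to [0].  *)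
(**                                                                             *)
(** If [I] is an Erdos-Ulam ideal and a pointwise bounded sequence [mu_k] is    *)
(** unbounded on [I], then every set can be split into two halves of about half *)
(** the upper density, one of which still carries the unboundedness. This       *)
(** yields sets [P_j] decreasing to upper density [0] and disjoint [B_j] in [I] *)
(** with [B_j] included in [P_j] and [mu_(k_j)(B_j)] large; all unions of the   *)
(** [B_j] are in [I], and a gliding hump argument gives a contradiction.        *)
(**                                                                             *)
(** Conversely, [W_n] minus its total mass times the two-valued measure of the  *)
(** dual filter converges to [0] on the algebra, so the Nikodym property bounds *)
(** the masses of the [W_n]; applied to multiples of point masses, the same     *)
(** trick makes the point weights tend to [0]. As [I] is proper, infinitely     *)
(** many masses exceed some [c > 0]; attaching at most one lighter block to     *)
(** each of those gives blocks with masses in a compact subset of [(0, oo)].    *)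
(** Listing the blocks one after another, with the [j]-th one rescaled to have  *)
(** mass [2 ^ j], produces the Erdos-Ulam function.                             *)

Require Import Defs.
From mathcomp Require Import all_boot all_order all_algebra.
From mathcomp Require Import all_classical all_reals all_analysis.
From mathcomp Require Import lra.

Set Implicit Arguments.
Unset Strict Implicit.
Unset Printing Implicit Defensive.

Import Order.TTheory GRing.Theory Num.Theory.
Import numFieldNormedType.Exports.
Local Open Scope classical_set_scope.
Local Open Scope ring_scope.

(** * The gliding hump *)

(** By [density_ideal_blocks], a density ideal is given by positive point weights and a partition of
    omega into finite blocks: a set belongs to it iff its block sums tend to 0.

    For an Erdos-Ulam ideal, single weights are negligible against the partial sums, so any set can
    be halved in upper density ([upper_density_split]). Hence [erdos_ulam_unbounded_step] can push
    the unboundedness of a sequence of additive functions into sets of ever smaller density,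
    splitting off disjoint witnesses on the way. All unions of the witnesses lie in the ideal, which
    yields additive functions on the full power set of the indices; there [gliding_hump] gives the
    contradiction.

    Conversely, [nikodym_ideal_bounded] turns the Nikodym property into uniform bounds on the ideal
    for non-negative additive functions tending to 0 on it. Block sums and multiples of point masses
    are two instances: the block masses are bounded and the point weights tend to 0. After
    [merge_blocks] has also bounded the masses away from 0, [blocks_erdos_ulam] lays the blocks out
    on a geometric scale, where the density quotient of a set tends to 0 iff the proportion of the
    blocks that it fills does. *)

Lemma cvg0P (R : realType) (u : nat -> R) :
  u n @[n --> \oo] --> 0 <->
  forall e, 0 < e -> exists N, forall n, (N <= n)%N -> `|u n| <= e.
Proof.
split=> [/cvgrPdist_le cu e e0|cu].
  have [N _ HN] := cu e e0; exists N => n Nn.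
  by have := HN n Nn; rewrite /= sub0r normrN.
apply/cvgrPdist_le => e e0; have [N HN] := cu e e0.
by exists N => // n Nn /=; rewrite sub0r normrN; apply: HN.
Qed.

(* If [b] bounds the oscillation of [nu] on the union of two disjoint sets,   *)
(* then [b / 2] bounds it on one of them.                                     *)
Lemma oscillation_subsequence (R : realType) (nu : set nat -> R) (b : R)
    (j : nat -> nat) (t : nat) :
  (forall X Y, X `&` Y = set0 -> nu (X `|` Y) = nu X + nu Y) ->
  (forall X Y, nu X - nu Y <= b) -> {homo j : m n / (m < n)%N} ->
  exists2 h : nat -> nat, {homo h : m n / (m < n)%N} &
    forall X Y, X `<=` range (j \o h) -> Y `<=` range (j \o h) ->
      nu X - nu Y <= b / 2 ^+ t.
Proof.
move=> addnu bnu jmono.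
have jinj : injective j by apply: incn_inj; exact: leq_mono.
elim: t => [|t [h hmono hb]].
  by exists id => // X Y _ _; rewrite expr0 divr1.
(* Pass to the even or to the odd terms. If both failed, the unions of the two violating pairs would
   violate the bound for [h]. *)
pose h0 n := h n.*2; pose h1 n := h n.*2.+1.
have hinj : injective h by apply: incn_inj; exact: leq_mono.
have h0mono : {homo h0 : m n / (m < n)%N}.
  by move=> m n mn; apply: hmono; rewrite ltn_double.
have h1mono : {homo h1 : m n / (m < n)%N}.
  by move=> m n mn; apply: hmono; rewrite ltnS ltn_double.
pose ok (k : nat -> nat) := forall X Y, X `<=` range (j \o k) -> Y `<=` range (j \o k) ->
      nu X - nu Y <= b / 2 ^+ t.+1.
have [ok0|nok0] := pselect (ok h0); first by exists h0.
have [ok1|nok1] := pselect (ok h1); first by exists h1.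
move: nok0 => /existsNP[X0 /existsNP[Y0 /not_implyP[X0j /not_implyP[Y0j]]]].
move: nok1 => /existsNP[X1 /existsNP[Y1 /not_implyP[X1j /not_implyP[Y1j]]]].
move=> /negP; rewrite -ltNge => lt1 /negP; rewrite -ltNge => lt0.
have disj A B : A `<=` range (j \o h0) -> B `<=` range (j \o h1) ->
    A `&` B = set0.
  move=> Aj Bj; apply/seteqP; split=> // x [/Aj[m _ <-] /Bj[n _]] /= /jinj/hinj.
  by move/(congr1 odd); rewrite /= !odd_double.
have sub A B : A `<=` range (j \o h0) -> B `<=` range (j \o h1) ->
    A `|` B `<=` range (j \o h).
  by move=> Aj Bj x [/Aj|/Bj] [m _ <-]; [exists m.*2 | exists m.*2.+1].
have := hb _ _ (sub _ _ X0j X1j) (sub _ _ Y0j Y1j).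
rewrite !addnu ?disj// => le.
have e2 : b / 2 ^+ t = b / 2 ^+ t.+1 + b / 2 ^+ t.+1.
  by rewrite exprS invfM; lra.
by exfalso; move: lt0 lt1 le; rewrite e2; lra.
Qed.

(** After enough halvings the oscillation is at most 1; comparison with the empty set, where [nu]
    vanishes, turns this into a bound on absolute values. *)
Lemma small_subsequence (R : realType) (nu : set nat -> R) (j : nat -> nat) :
  (forall X Y, X `&` Y = set0 -> nu (X `|` Y) = nu X + nu Y) ->
  (exists M, forall X, `|nu X| <= M) -> {homo j : m n / (m < n)%N} ->
  exists2 h : nat -> nat, {homo h : m n / (m < n)%N} &
    forall X, X `<=` range (j \o h) -> `|nu X| <= 1.
Proof.
move=> addnu [M Mnu] jmono.
have osc X Y : nu X - nu Y <= M + M.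
  have := Mnu X; have := Mnu Y; rewrite !ler_norml => /andP[? ?] /andP[? ?]; lra.
have M0 : 0 <= M by apply: le_trans (normr_ge0 _) (Mnu set0).
have nu0 : nu set0 = 0.
  have := addnu set0 set0 (setI0 _); rewrite setU0; lra.
have [h hmono hb] := oscillation_subsequence (Num.truncn (M + M)).+1 addnu osc jmono.
exists h => // X Xj.
have t0 : 0 < 2 ^+ (Num.truncn (M + M)).+1 :> R by rewrite exprn_gt0.
have le1 : (M + M) / 2 ^+ (Num.truncn (M + M)).+1 <= 1.
  rewrite ler_pdivrMr// mul1r; apply: le_trans (ltW (truncnS_gt _)) _.
  by rewrite -natrX ler_nat ltnW// ltn_expl.
have s0 : set0 `<=` range (j \o h) by [].
have := hb _ _ Xj s0; have := hb _ _ s0 Xj; rewrite nu0.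
rewrite ler_norml; lra.
Qed.

Lemma dependent_choice (T : Type) (inv : nat -> T -> Prop)
    (stp : nat -> T -> T -> Prop) (s0 : T) : inv 0%N s0 ->
  (forall n s, inv n s -> exists2 s', inv n.+1 s' & stp n s s') ->
  exists st : nat -> T, forall n, inv n (st n) /\ stp n (st n) (st n.+1).
Proof.
move=> inv0 next.
have next' n s : exists s', inv n s -> inv n.+1 s' /\ stp n s s'.
  by have [/next[s' ? ?]|ninv] := pselect (inv n s); [exists s' | exists s].
pose G n s := projT1 (cid (next' n s)).
have HG n s : inv n s -> inv n.+1 (G n s) /\ stp n s (G n s).
  exact: (projT2 (cid (next' n s))).
pose st := fix st n := if n is m.+1 then G m (st m) else s0.
have stinv n : inv n (st n) by elim: n => //= n /HG[].
by exists st => n; split=> //; exact: (HG n _ (stinv n)).2.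
Qed.

(** Choose indices one by one so that the value of [nu i] at [[set i]] dominates its value on the
    earlier indices, and thin out the remaining indices so that [nu i] is at most 1 in absolute
    value on every set of later ones. The chosen [nu i] are then unbounded on the set of all chosen
    indices. *)
Lemma gliding_hump (R : realType) (nu : nat -> set nat -> R) :
  (forall k X Y, X `&` Y = set0 -> nu k (X `|` Y) = nu k X + nu k Y) ->
  (forall k, exists M, forall X, `|nu k X| <= M) ->
  (forall X, exists M, forall k, `|nu k X| <= M) ->
  ~ forall i, i%:R < `|nu i [set i]|.
Proof.
move=> addnu bnu pnu big.
(* A state consists of the set of indices chosen so far, the last of them, and the subsequence from
   which all later ones are drawn. *)
pose inv (_ : nat) (s : set nat * nat * (nat -> nat)) :=
  {homo s.2 : m n / (m < n)%N} /\ s.1.1 `&` range s.2 = set0.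
pose stp n (s s' : set nat * nat * (nat -> nat)) :=
  [/\ s'.1.1 = s.1.1 `|` [set s'.1.2], range s.2 s'.1.2,
      `|nu s'.1.2 s.1.1| + n%:R + 1 < `|nu s'.1.2 [set s'.1.2]|,
      range s'.2 `<=` range s.2 &
      forall X, X `<=` range s'.2 -> `|nu s'.1.2 X| <= 1].
have [|n s [smono sdisj]|st Hst] := @dependent_choice _ inv stp (set0, 0%N, id).
- by split=> //=; rewrite set0I.
- have [M HM] := pnu s.1.1.
  (* As [i] is at least [q], its singleton value exceeds [M + n%:R + 1], where [M] bounds all [nu k]
     on the set chosen so far. *)
  pose q := (Num.truncn (M + n%:R + 1)).+1; pose i := s.2 q.
  have sge m : (m <= s.2 m)%N.
    by elim: m => // m IH; apply: leq_ltn_trans IH _; exact: smono.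
  have jmono : {homo (fun m => s.2 (q + m.+1)%N) : m n / (m < n)%N}.
    by move=> a b ab; apply: smono; rewrite ltn_add2l.
  have [h hmono hb] := small_subsequence (addnu i) (bnu i) jmono.
  exists (s.1.1 `|` [set i], i, fun m => s.2 (q + (h m).+1)%N).
    split; first by move=> a b /= ab; apply: jmono; exact: hmono.
    rewrite /= setIUl; apply/seteqP; split=> // x [[sx [m _ xE]]|[-> [m _]]].
      have : (s.1.1 `&` range s.2) x by split=> //; exists (q + (h m).+1)%N.
      by rewrite sdisj.
    move/(incn_inj (leq_mono smono))/eqP.
    by rewrite -{2}[q]addn0 eqn_add2l.
  split=> //=; first by exists q.
    apply: le_lt_trans (big i); apply: le_trans (_ : M + n%:R + 1 <= _).
      by rewrite !lerD2r.
    apply: le_trans (ltW (truncnS_gt _)) _; rewrite ler_nat; exact: sge.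
  by move=> x [m _ <-]; exists (q + (h m).+1)%N.
have stinv n : inv n (st n) := (Hst n).1.
have stS n : stp n (st n) (st n.+1) := (Hst n).2.
pose A := \bigcup_n (st n).1.1.
have subj m d : range (st (m + d)%N).2 `<=` range (st m).2.
  elim: d => [|d IH]; first by rewrite addn0.
  by rewrite addnS; apply: subset_trans IH; case: (stS (m + d)%N).
have subF m d : (st (m + d)%N).1.1 `<=` (st m).1.1 `|` range (st m).2.
  elim: d => [|d IH]; first by rewrite addn0 => x; left.
  rewrite addnS; case: (stS (m + d)%N) => -> jx _ _ _ x [/IH //|->].
  by right; exact: subj jx.
have monoF m d : (st m).1.1 `<=` (st (m + d)%N).1.1.
  elim: d => [|d IH]; first by rewrite addn0.
  rewrite addnS; case: (stS (m + d)%N) => -> _ _ _ _ x /IH; by left.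
have subA m : A `<=` (st m).1.1 `|` range (st m).2.
  move=> x [n _ nx]; case: (leqP m n) => [mn|/ltnW mn].
    by apply: (@subF m (n - m)%N); rewrite subnKC.
  by left; rewrite -(subnKC mn); exact: monoF.
have [M HM] := pnu A.
pose n := (Num.truncn M).+1.
case: (stS n); set i := (st n.+1).1.2 => FE ji lti _ tail.
have iF : (st n).1.1 `&` [set i] = set0.
  have [_ d] := stinv n; apply/seteqP; split=> // x [Fx /= xi].
  have : ((st n).1.1 `&` range (st n).2) x by rewrite xi in Fx *; split.
  by rewrite d.
have Adec : A = (st n.+1).1.1 `|` (A `\` (st n.+1).1.1).
  by rewrite setDUK// => x Fx; exists n.+1.
have := HM i; rewrite Adec addnu ?setDIK// FE addnu// -FE.
have /tail : A `\` (st n.+1).1.1 `<=` range (st n.+1).2.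
  by move=> x [/(subA n.+1)[]].
have := truncnS_gt M; rewrite -/n.
set a := nu i _ in lti *; set b := nu i _ in lti *; set c := nu i _.
have tri : `|b| <= `|a + b + c| + `|a| + `|c|.
  have E : b = (a + b + c) - a - c by lra.
  by rewrite [X in `|X| <= _]E; apply: le_trans (ler_normB _ _) _; rewrite lerD2r ler_normB.
lra.
Qed.

(** * Erdos-Ulam ideals have the Nikodym property *)

Definition partial_sum (R : realType) (f : nat -> R) (A : set nat) (n : nat) : R :=
  \sum_(0 <= i < n | i \in A) f i.

Definition upper_density_le (R : realType) (f : nat -> R) (e : R) (A : set nat) :=
  exists N, forall n, (N <= n)%N ->
    partial_sum f A n <= e * \sum_(0 <= i < n) f i.

Lemma partial_sumT (R : realType) (f : nat -> R) n :
  partial_sum f setT n = \sum_(0 <= i < n) f i.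
Proof. by apply: eq_bigl => i; rewrite in_setT. Qed.

Lemma partial_sum_ge0 (R : realType) (f : nat -> R) A n :
  (forall i, 0 <= f i) -> 0 <= partial_sum f A n.
Proof. by move=> f0; apply: sumr_ge0. Qed.

Lemma partial_sumS (R : realType) (f : nat -> R) A n :
  partial_sum f A n.+1 = partial_sum f A n + (if n \in A then f n else 0).
Proof. by rewrite /partial_sum big_mkcond big_nat_recr//= -big_mkcond. Qed.

Lemma le_partial_sum (R : realType) (f : nat -> R) A B n :
  (forall i, 0 <= f i) -> A `<=` B -> partial_sum f A n <= partial_sum f B n.
Proof.
move=> f0 AB; elim: n => [|n IH]; first by rewrite /partial_sum !big_nil.
rewrite !partial_sumS lerD//; case: ifPn => nA; last by case: ifP.
by rewrite ifT//; move: nA; rewrite !in_setE; exact: AB.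
Qed.

Lemma partial_sumU (R : realType) (f : nat -> R) A B n :
  (forall i, 0 <= f i) ->
  partial_sum f (A `|` B) n <= partial_sum f A n + partial_sum f B n.
Proof.
move=> f0; elim: n => [|n IH]; first by rewrite /partial_sum !big_nil addr0.
rewrite !partial_sumS addrACA lerD// in_setU.
by case: (n \in A); case: (n \in B); rewrite /= ?addr0 ?add0r// lerDl.
Qed.

Lemma le_partial_sum_total (R : realType) (f : nat -> R) m n :
  (forall i, 0 <= f i) -> (m <= n)%N ->
  \sum_(0 <= i < m) f i <= \sum_(0 <= i < n) f i.
Proof.
by move=> f0 mn; rewrite (big_cat_nat (leq0n m) mn)//= lerDl sumr_ge0.
Qed.

Lemma partial_sum_total_gt0 (R : realType) (f : nat -> R) n :
  (forall i, 0 < f i) -> (0 < n)%N -> 0 < \sum_(0 <= i < n) f i.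
Proof.
move=> f0; case: n => // n _; rewrite big_nat_recr//=.
by rewrite ltr_wpDl// sumr_ge0// => i _; exact: ltW.
Qed.

Lemma partial_sum_cvgy (R : realType) (f : nat -> R) (C : R) :
  erdos_ulam_fun f ->
  exists N, forall n, (N <= n)%N -> C <= \sum_(0 <= i < n) f i.
Proof.
case=> _ /cvgryPge /(_ C)[N _ HN] _; exists N => n Nn; exact: HN.
Qed.

Lemma erdos_ulam_idealP (R : realType) (f : nat -> R) A :
  (forall i, 0 < f i) ->
  erdos_ulam_ideal f A <-> forall e, 0 < e -> upper_density_le f e A.
Proof.
move=> f0; have f0' i : 0 <= f i by exact: ltW.
rewrite /erdos_ulam_ideal /= cvg0P; split=> H e e0.
  have [N HN] := H e e0; exists (maxn N 1) => n; rewrite geq_max => /andP[Nn n0].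
  have := HN n Nn; rewrite ger0_norm; last first.
    by rewrite divr_ge0 ?partial_sum_ge0 ?sumr_ge0.
  by rewrite ler_pdivrMr// partial_sum_total_gt0.
have [N HN] := H e e0; exists (maxn N 1) => n; rewrite geq_max => /andP[Nn n0].
rewrite ger0_norm ?divr_ge0 ?partial_sum_ge0 ?sumr_ge0//.
by rewrite ler_pdivrMr ?partial_sum_total_gt0//; exact: HN.
Qed.

Lemma erdos_ulam_ideal0 (R : realType) (f : nat -> R) :
  (forall i, 0 < f i) -> erdos_ulam_ideal f set0.
Proof.
move=> f0; apply/erdos_ulam_idealP => // e e0; exists 0%N => n _.
rewrite /partial_sum big_pred0; last by move=> i; rewrite in_set0.
by rewrite mulr_ge0 ?sumr_ge0 ?ltW// => i _; exact: ltW.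
Qed.

Lemma erdos_ulam_idealS (R : realType) (f : nat -> R) A B :
  (forall i, 0 < f i) ->
  A `<=` B -> erdos_ulam_ideal f B -> erdos_ulam_ideal f A.
Proof.
move=> f0 AB; rewrite !erdos_ulam_idealP// => H e e0.
have [N HN] := H e e0; exists N => n Nn; apply: le_trans (HN n Nn).
by apply: le_partial_sum AB => i; exact: ltW.
Qed.

Lemma erdos_ulam_idealU (R : realType) (f : nat -> R) A B :
  (forall i, 0 < f i) ->
  erdos_ulam_ideal f A -> erdos_ulam_ideal f B -> erdos_ulam_ideal f (A `|` B).
Proof.
move=> f0; rewrite !erdos_ulam_idealP// => HA HB e e0.
have e2 : 0 < e / 2 by lra.
have [N HN] := HA _ e2; have [N' HN'] := HB _ e2.
exists (maxn N N') => n; rewrite geq_max => /andP[Nn N'n].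
apply: le_trans (partial_sumU _ _ _ _) _; first by move=> i; exact: ltW.
by rewrite [e in e * _]splitr mulrDl; apply: lerD; [exact: HN|exact: HN'].
Qed.

(** The weight of the first half minus that of the second, on the points below [n]; a point of [P]
    joins the first half iff the difference before it is negative. *)
Fixpoint greedy_balance (R : realType) (f : nat -> R) (P : set nat) (n : nat) : R :=
  if n is m.+1 then
    let D := greedy_balance f P m in
    if m \in P then (if 0 <= D then D - f m else D + f m) else D
  else 0.

(* Assigning each point of [P] greedily to the lighter half keeps the         *)
(* imbalance below the largest weight seen so far, which is [o(sum f)].       *)
Lemma upper_density_split (R : realType) (f : nat -> R) (P : set nat) (e : R) :
  erdos_ulam_fun f -> 0 < e -> upper_density_le f e P ->
  exists Q, [/\ Q `<=` P, upper_density_le f (5 / 8 * e) Q &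
                upper_density_le f (5 / 8 * e) (P `\` Q)].
Proof.
move=> EUf e0 [N HN]; have [f0 _ fo] := EUf.
have f0' i : 0 <= f i by exact: ltW.
pose D := greedy_balance f P.
pose Q := [set n | P n /\ D n < 0].
pose S n := \sum_(0 <= i < n) f i.
have DSE n : D n.+1 =
    if n \in P then (if 0 <= D n then D n - f n else D n + f n) else D n by [].
have DE n : partial_sum f Q n - partial_sum f (P `\` Q) n = D n /\
    partial_sum f Q n + partial_sum f (P `\` Q) n = partial_sum f P n.
  elim: n => [|n [IH1 IH2]]; first by rewrite /partial_sum !big_nil subrr addr0.
  rewrite !partial_sumS DSE in_setD.
  have [Pn|Pn] := boolP (n \in P); last first.
    have -> : n \in Q = false by apply/negP; rewrite in_setE => -[/mem_set]; rewrite (negbTE Pn).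
    by rewrite /= !addr0.
  have [Dn|Dn] := leP 0 (D n).
    have -> : n \in Q = false by apply/negP; rewrite in_setE => -[_]; rewrite ltNge Dn.
    by rewrite /=; split; lra.
  have -> : n \in Q = true by apply/mem_set; split=> //; exact/set_mem.
  by rewrite /=; split; lra.
have DS n : `|D n.+1| <= Num.max `|D n| (f n).
  rewrite le_max DSE; case: ifP => _; last by rewrite lexx.
  have := f0 n; have [Dn|Dn] := leP 0 (D n) => fn.
    rewrite [`|D n|]ger0_norm//; apply/orP; have [le|lt] := leP (f n) (D n).
      by left; rewrite ger0_norm; lra.
    by right; rewrite ltr0_norm; lra.
  rewrite (ltr0_norm Dn); apply/orP; have [le|lt] := leP (f n) (- D n).
    by left; rewrite ler0_norm; lra.
  by right; rewrite gtr0_norm; lra.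
have [N1 HN1] : exists N1, forall n, (N1 <= n)%N -> f n <= e / 4 * S n.+1.
  have e4 : 0 < e / 4 by lra.
  have [N1 HN1] := (cvg0P _).1 fo _ e4; exists N1 => n Nn.
  rewrite -ler_pdivrMr ?partial_sum_total_gt0//.
  by apply: le_trans (HN1 n Nn); rewrite ler_norm.
have Dle n : (N1 <= n)%N -> `|D n| <= Num.max `|D N1| (e / 4 * S n).
  elim: n => [|n IH]; first by rewrite leqn0 => /eqP ->; rewrite le_max lexx.
  rewrite leq_eqVlt => /predU1P[<-|]; first by rewrite le_max lexx.
  rewrite ltnS => Nn; apply: le_trans (DS n) _.
  have SS : e / 4 * S n <= e / 4 * S n.+1.
    by rewrite ler_wpM2l ?le_partial_sum_total//; lra.
  have := IH Nn; rewrite ge_max !le_max => /orP[->|H] /=.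
    by rewrite (HN1 n Nn) orbT.
  by rewrite (HN1 n Nn) (le_trans H SS) !orbT.
(* The divergence of the partial sums absorbs the imbalance present at [N1]. *)
have [N2 HN2] := partial_sum_cvgy (`|D N1| * 4 / e) EUf.
have bal n : (N2 <= n)%N -> (N1 <= n)%N -> `|D n| <= e / 4 * S n.
  move=> N2n N1n; apply: le_trans (Dle _ N1n) _; rewrite ge_max lexx andbT.
  have := HN2 n N2n; rewrite ler_pdivrMr// -/(S n) => H.
  by apply: le_trans (_ : (S n * e) / 4 <= _); lra.
(* Each half weighs half of the total plus at most half of the imbalance:
   [(e + e / 4) / 2 = 5 / 8 * e]. *)
exists Q; split; first by move=> n [].
  exists (maxn N (maxn N1 N2)) => n; rewrite !geq_max => /and3P[Nn N1n N2n].
  have := bal n N2n N1n; have [] := DE n; have := HN n Nn; rewrite -/(S n).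
  move=> H1 H2 H3; rewrite ler_norml => /andP[_ H4].
  move: (partial_sum f P n) (partial_sum f Q n) (partial_sum f (P `\` Q) n) H1 H2 H3 H4.
  by move=> p q r; lra.
exists (maxn N (maxn N1 N2)) => n; rewrite !geq_max => /and3P[Nn N1n N2n].
have := bal n N2n N1n; have [] := DE n; have := HN n Nn; rewrite -/(S n).
move=> H1 H2 H3; rewrite ler_norml => /andP[H4 _].
move: (partial_sum f P n) (partial_sum f Q n) (partial_sum f (P `\` Q) n) H1 H2 H3 H4.
by move=> p q r; lra.
Qed.

Lemma cvg0_bounded (R : realType) (u : nat -> R) :
  u n @[n --> \oo] --> 0 -> exists M, forall n, `|u n| <= M.
Proof.
move=> /cvg0P/(_ 1 ltr01)[N HN]; exists (1 + \sum_(i < N) `|u i|) => n.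
have [Nn|nN] := leqP N n.
  by apply: le_trans (HN n Nn) _; rewrite lerDl sumr_ge0.
apply: le_trans (_ : \sum_(i < N) `|u i| <= _); last by rewrite lerDr.
by rewrite (bigD1 (Ordinal nN))//= lerDl sumr_ge0.
Qed.

(** By additivity, unboundedness on a set passes to one of any two pieces of it; first it is passed
    to a half [P1] of smaller density. A witness [B] inside [P1] can be split off if [P1] without
    [B] is still unbounded. Otherwise [B] itself is unbounded and has to be divided further. *)
Lemma erdos_ulam_unbounded_step (R : realType) (f : nat -> R)
    (mu : nat -> set nat -> R) (P : set nat) (e C : R) :
  let J := erdos_ulam_ideal f in
  let unbounded P := forall C, exists k B, [/\ J B, B `<=` P & C < `|mu k B|] in
  erdos_ulam_fun f ->
  (forall k, finitely_additive J (mu k)) ->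
  (forall X, J X -> exists M, forall k, `|mu k X| <= M) ->
  unbounded P -> 0 < e -> upper_density_le f e P ->
  exists k B P', [/\ J B, B `<=` P, P' `<=` P, B `&` P' = set0 &
    [/\ unbounded P', upper_density_le f (5 / 8 * e) P' & C < `|mu k B|]].
Proof.
move=> J unbounded EUf addm pm; have [f0 _ _] := EUf.
have JS A B : A `<=` B -> J B -> J A by exact: erdos_ulam_idealS.
have Usplit A Q : unbounded A -> unbounded (A `&` Q) \/ unbounded (A `\` Q).
  move=> UA; apply: contrapT => /not_orP[/existsNP[C1 H1] /existsNP[C2 H2]].
  have [k [B [JB BA]]] := UA (C1 + C2); apply/negP; rewrite -leNgt.
  rewrite -(setUIDK B Q) addm.
  - apply: le_trans (ler_normD _ _) _; apply: lerD; rewrite leNgt; apply/negP => lt.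
      apply: H1; exists k, (B `&` Q); split=> //; last exact: setSI.
      by apply: JS JB => x [].
    apply: H2; exists k, (B `\` Q); split=> //; last exact: setSD.
    by apply: JS JB => x [].
  - by apply: JS JB => x [].
  - by apply: JS JB => x [].
  - by apply/seteqP; split=> // x [[_ ?] [_]].
move=> UP e0 udP.
have [P1 [P1P UP1 udP1]] :
    exists P1, [/\ P1 `<=` P, unbounded P1 & upper_density_le f (5 / 8 * e) P1].
  have [Q [QP udQ udPQ]] := upper_density_split EUf e0 udP.
  have [UQ|UQ] := Usplit _ Q UP; last by exists (P `\` Q); split=> // x [].
  by exists Q; split=> //; rewrite (setIidr QP) in UQ.
have udS A : A `<=` P1 -> upper_density_le f (5 / 8 * e) A.
  move=> AP; have [N HN] := udP1; exists N => n Nn; apply: le_trans (HN n Nn).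
  by apply: le_partial_sum AP => i; exact: ltW.
have [k [B [JB BP CB]]] := UP1 C.
have [UB|UB] := Usplit _ B UP1; last first.
  exists k, B, (P1 `\` B); split=> //.
  - exact: subset_trans P1P.
  - by move=> x [/P1P].
  - by rewrite setDIK.
  - by split=> //; apply: udS => x [].
rewrite (setIidr BP) in UB.
have [M HM] := pm B JB.
(* Since [M] bounds all [mu k] on [B], a value above [C + M] at [D] forces [mu l] to exceed [C] in
   absolute value both at [D] and at [B] without [D]. Whichever of the two stays unbounded becomes
   [P'], the other is the witness. *)
have [l [D [JD DB lt]]] := UB (C + M).
have JBD : J (B `\` D) by apply: JS JB => x [].
have lD : C < `|mu l D|.
  have := normr_ge0 (mu l B); have := HM l; lra.
have lBD : C < `|mu l (B `\` D)|.
  have := HM l; rewrite -{1}(setDUK DB) addm ?setDIK// => HM'.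
  have := ler_normB (mu l D + mu l (B `\` D)) (mu l (B `\` D)); rewrite addrK; lra.
have BsP : B `<=` P by exact: subset_trans P1P.
have [UD|UD] := Usplit _ D UB.
  rewrite (setIidr DB) in UD.
  exists l, (B `\` D), D; split=> //.
  - by move=> x [/BsP].
  - exact: subset_trans BsP.
  - by rewrite setDKI.
  - by split=> //; apply: udS; exact: subset_trans BP.
exists l, D, (B `\` D); split=> //.
- exact: subset_trans BsP.
- by move=> x [/BsP].
- by rewrite setDIK.
- by split=> //; apply: udS => x [/BP].
Qed.

Lemma erdos_ulam_unif_bounded (R : realType) (f : nat -> R)
    (mu : nat -> set nat -> R) :
  let J := erdos_ulam_ideal f in
  erdos_ulam_fun f ->
  (forall k, finitely_additive J (mu k)) ->
  (forall k, bounded_on J (mu k)) ->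
  (forall X, J X -> exists M, forall k, `|mu k X| <= M) ->
  exists M, forall k X, J X -> `|mu k X| <= M.
Proof.
move=> J EUf addm bm pm; have [f0 _ _] := EUf.
have f0' i : 0 <= f i by exact: ltW.
have JS A B : A `<=` B -> J B -> J A by exact: erdos_ulam_idealS.
pose unbounded P := forall C, exists k B, [/\ J B, B `<=` P & C < `|mu k B|].
apply: contrapT => /forallNP nb.
have UT : unbounded setT.
  move=> C; have /existsNP[k /existsNP[B /not_implyP[JB /negP]]] := nb C.
  by rewrite -ltNge => lt; exists k, B; split.
pose inv n (s : set nat * set nat * nat) :=
  unbounded s.1.1 /\ upper_density_le f ((5 / 8) ^+ n) s.1.1.
pose stp n (s s' : set nat * set nat * nat) :=
  [/\ J s'.1.2, s'.1.2 `<=` s.1.1, s'.1.1 `<=` s.1.1, s'.1.2 `&` s'.1.1 = set0 &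
     n%:R < `|mu s'.2 s'.1.2|].
have e0 n : 0 < (5 / 8) ^+ n :> R by rewrite exprn_gt0//; lra.
have [|n s [Us uds]|st Hst] := @dependent_choice _ inv stp (setT, set0, 0%N).
- by split=> //; exists 0%N => n _; rewrite partial_sumT expr0 mul1r.
- have [k [B [P' [JB BP PP BP0 [UP' udP' lt]]]]] :=
    erdos_ulam_unbounded_step n%:R EUf addm pm Us (e0 n) uds.
  by exists (P', B, k); split=> //=; rewrite exprS.
pose P n := (st n).1.1; pose B n := (st n.+1).1.2; pose k n := (st n.+1).2.
have JB n : J (B n) by have [_ []] := Hst n.
have BP n : B n `<=` P n by have [_ []] := Hst n.
have BP0 n : B n `&` P n.+1 = set0 by have [_ []] := Hst n.
have PS m d : P (m + d)%N `<=` P m.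
  elim: d => [|d IH]; first by rewrite addn0.
  by rewrite addnS; apply: subset_trans IH; have [_ []] := Hst (m + d)%N.
have tB : trivIset setT B.
  apply: ltn_trivIset => m n nm; rewrite setIC.
  apply/seteqP; split=> // x [/BP mx nx].
  by rewrite -(BP0 n); split=> //; apply: (@PS n.+1 (m - n.+1)%N); rewrite subnKC.
(* A union of sets [B j] consists of finitely many of them, which lie in [J], and a rest inside
   [P m], whose upper density is at most [(5 / 8) ^+ m]. *)
have JU M : J (\bigcup_(j in M) B j).
  apply/erdos_ulam_idealP => // e epos.
  have [m Hm] : exists m, (5 / 8) ^+ m <= e / 2 :> R.
    have lt1 : `|5 / 8 : R| < 1 by rewrite ger0_norm; lra.
    have e2 : 0 < e / 2 by lra.
    have [m Hm] := (cvg0P _).1 (cvg_expr lt1) _ e2; exists m.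
    by apply: le_trans (Hm m (leqnn _)); exact: ler_norm.
  pose F := \big[setU/set0]_(j < m) B j.
  have JF : J F.
    rewrite /F; elim: m {Hm F} => [|m IH].
      by rewrite big_ord0; exact: erdos_ulam_ideal0.
    by rewrite big_ord_recr /=; apply: erdos_ulam_idealU => //; exact: JB.
  have sub : \bigcup_(j in M) B j `<=` F `|` P m.
    move=> x [j _ jx]; have [jm|mj] := ltnP j m.
      by left; rewrite /F -bigcup_mkord; exists j.
    by right; apply: (@PS m (j - m)%N); rewrite subnKC//; exact: BP.
  have e2 : 0 < e / 2 by lra.
  have [N HN] := (erdos_ulam_idealP _ f0).1 JF _ e2.
  have [[_ [N' HN']] _] := Hst m.
  exists (maxn N N') => n; rewrite geq_max => /andP[Nn N'n].
  apply: le_trans (le_partial_sum _ f0' sub) _.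
  apply: le_trans (partial_sumU _ _ _ f0') _.
  rewrite [e in e * _]splitr mulrDl; apply: lerD; first exact: HN.
  by apply: le_trans (HN' n N'n) _; rewrite ler_wpM2r ?sumr_ge0.
(* Sets of indices now play the role of the sets in [J], so [nu i] is additive on the whole power
   set of omega. *)
pose nu i M := mu (k i) (\bigcup_(j in M) B j).
apply: (@gliding_hump _ nu).
- move=> i X Y XY; rewrite /nu bigcup_setU addm//.
  apply/seteqP; split=> // x [[a Xa ax] [b Yb bx]].
  have ab : a = b by apply: tB => //; exists x.
  have : (X `&` Y) a by split=> //; rewrite ab.
  by rewrite XY.
- by move=> i; have [M HM] := bm (k i); exists M => X; exact: HM.
- by move=> X; have [M HM] := pm _ (JU X); exists M => i; exact: HM.
- by move=> i; rewrite /nu bigcup_set1; have [_ []] := Hst i.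
Qed.

(** The value at the complement of [A] is the value at [setT] minus that at [A], and the values at
    [setT] form a convergent sequence; so a uniform bound on the ideal suffices. *)
Lemma erdos_ulam_nikodym (R : realType) (f : nat -> R) :
  erdos_ulam_fun f ->
  nikodym R (erdos_ulam_ideal f `|` dual_filter (erdos_ulam_ideal f)).
Proof.
move=> EUf mu addm bm cm; have [f0 _ _] := EUf.
set J := erdos_ulam_ideal f in addm bm cm *.
have BT : (J `|` dual_filter J) setT.
  by right; exists set0; [exact: erdos_ulam_ideal0 | rewrite setC0].
have [M HM] : exists M, forall k X, J X -> `|mu k X| <= M.
  apply: (erdos_ulam_unif_bounded EUf).
  - by move=> k X Y JX JY; apply: addm; left.
  - by move=> k; have [M HM] := bm k; exists M => X JX; apply: HM; left.
  - by move=> X JX; apply: cvg0_bounded; apply: cm; left.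
have [M' HM'] := cvg0_bounded (cm _ BT).
have HB k X : (J `|` dual_filter J) X -> `|mu k X| <= M + M'.
  have M'0 : 0 <= M' by apply: le_trans (normr_ge0 _) (HM' 0%N).
  case=> [JX|[A JA <-]]; first by apply: le_trans (HM k X JX) _; lra.
  have -> : mu k (~` A) = mu k setT - mu k A.
    rewrite -(setUv A) addm ?setICr//; [lra|by left|by right; exists A].
  by apply: le_trans (ler_normB _ _) _; rewrite addrC lerD ?HM.
exists ((M + M') + (M + M')) => n; apply: ge_ereal_sup => _ [X [Y [BX BY _ ->]]].
by rewrite lee_fin lerD ?HB.
Qed.

Lemma ideal_isomorphic_nikodym (R : realType) (I J : set (set nat)) :
  ideal_isomorphic I J -> nikodym R (J `|` dual_filter J) ->
  nikodym R (I `|` dual_filter I).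
Proof.
move=> [g [h gK hK] gI] nikJ mu addm bm cm.
have imE A : g @` A = h @^-1` A.
  apply/seteqP; split=> [_ [x Ax <-]|y hy]; first by rewrite /= gK.
  by exists (h y).
have hI A : J A <-> I (g @^-1` A).
  rewrite gI imE; have -> // : h @^-1` (g @^-1` A) = A.
  by apply/seteqP; split=> x /=; rewrite hK.
have BE A : (J `|` dual_filter J) A -> (I `|` dual_filter I) (g @^-1` A).
  case=> [/hI ?|[X /hI JX <-]]; first by left.
  by right; exists (g @^-1` X).
have BE' A : (I `|` dual_filter I) A -> (J `|` dual_filter J) (h @^-1` A).
  case=> [/gI|[X /gI]]; rewrite imE => JA; first by left.
  by move=> <-; right; exists (h @^-1` X).
have [||X /BE BX|M HM] := nikJ (fun n X => mu n (g @^-1` X)).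
- by move=> n X Y /BE BX /BE BY XY; rewrite preimage_setU addm// -preimage_setI XY.
- by move=> n; have [M HM] := bm n; exists M => X /BE; exact: HM.
- exact: cm.
exists M => n; apply: le_trans (HM n); apply: ge_ereal_sup => _ [X [Y [BX BY XY ->]]].
apply: ereal_sup_ubound; exists (h @^-1` X), (h @^-1` Y).
have ghK A : g @^-1` (h @^-1` A) = A by apply/seteqP; split=> x /=; rewrite gK.
by split; [exact: BE'|exact: BE'|rewrite -preimage_setI XY|rewrite !ghK].
Qed.

(** * Density ideals as block ideals *)

Definition block_sum (R : realType) (w : nat -> R) (s : seq nat) (A : set nat) : R :=
  \sum_(x <- s | x \in A) w x.

(** The lists [s n] enumerate the fibres of [b]; they partition omega into finite, possibly empty
    blocks. *)
Definition weighted_blocks (R : realType) (w : nat -> R) (b : nat -> nat)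
    (s : nat -> seq nat) : Prop :=
  [/\ forall x, 0 < w x, forall n, uniq (s n) & forall n x, (x \in s n) = (b x == n)].

Definition block_ideal (R : realType) (w : nat -> R) (s : nat -> seq nat) :
    set (set nat) :=
  [set A | block_sum w (s n) A @[n --> \oo] --> 0].

Lemma block_sum_ge0 (R : realType) (w : nat -> R) s A :
  (forall x, 0 <= w x) -> 0 <= block_sum w s A.
Proof. by move=> w0; apply: sumr_ge0. Qed.

Lemma le_block_sum (R : realType) (w : nat -> R) s A B :
  (forall x, 0 <= w x) -> A `<=` B -> block_sum w s A <= block_sum w s B.
Proof.
move=> w0 AB; rewrite /block_sum big_mkcond [leRHS]big_mkcond.
apply: ler_sum => x _; case: ifPn => xA; last by case: ifP.
by rewrite ifT//; apply/mem_set/AB/set_mem.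
Qed.

Lemma block_sumU (R : realType) (w : nat -> R) s A B : A `&` B = set0 ->
  block_sum w s (A `|` B) = block_sum w s A + block_sum w s B.
Proof.
move=> AB; rewrite /block_sum big_mkcond [X in _ = X + _]big_mkcond.
rewrite [X in _ = _ + X]big_mkcond -big_split; apply: eq_bigr => x _ /=.
rewrite in_setU; case: (boolP (x \in A)) => xA; case: (boolP (x \in B)) => xB;
  rewrite ?addr0 ?add0r//.
have : (A `&` B) x by split; exact/set_mem.
by rewrite AB.
Qed.

Lemma measure_finite_sum (R : realType) (mu : {finite_measure set nat -> \bar R})
    (t : seq nat) (A : set nat) : uniq t ->
  mu (A `&` [set` t]) = (\sum_(x <- t | x \in A) fine (mu [set x]))%:E.
Proof.
elim: t => [|x t IH] /=.
  by rewrite big_nil (_ : [set` [::]] = set0) ?setI0 ?measure0//; apply/seteqP; split.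
move=> /andP[xt ut]; rewrite big_cons.
have [xA|xA] := boolP (x \in A).
  have -> : A `&` [set` x :: t] = [set x] `|` (A `&` [set` t]).
    apply/seteqP; split=> y /=; rewrite inE.
      by case=> Ay /predU1P[->|ty]; [left|right].
    by case=> [->|[Ay ->]]; rewrite ?eqxx ?orbT; split=> //; exact/set_mem.
  rewrite measureU//=; last first.
    by apply/seteqP; split=> // y [/= -> [_ /=]]; rewrite (negbTE xt).
  by rewrite IH// EFinD fineK// fin_num_measure.
rewrite -IH//; congr (mu _); apply/seteqP; split=> y /= [Ay]; rewrite inE.
  by case/predU1P=> [yx|//]; rewrite yx in Ay; rewrite mem_set in xA.
by move=> ->; rewrite orbT.
Qed.

(** Countable additivity: the complement of the support is a countable union of null singletons. *)
Lemma measure_msupportC (R : realType) (mu : {finite_measure set nat -> \bar R}) :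
  mu (~` msupport mu) = 0%E.
Proof.
rewrite -[~` _]image_id -bigcup_imset1 measure_bigcup//=; last first.
  by move=> i j _ _ [x [/= -> ->]].
apply: eseries0 => i _ /=; rewrite in_setE /msupport /= => /negP.
by rewrite negbK => /eqP.
Qed.

Lemma measure_seq_sum (R : realType) (mu : {finite_measure set nat -> \bar R})
    (t : seq nat) (A : set nat) : uniq t -> msupport mu `<=` [set` t] ->
  mu A = (\sum_(x <- t | x \in A) fine (mu [set x]))%:E.
Proof.
move=> ut sub; rewrite -measure_finite_sum//.
rewrite -[in LHS](setUIDK A [set` t]) measureU//=; last first.
  by apply/seteqP; split=> // x [[_ ?] [_]].
rewrite [X in (_ + X)%E](_ : _ = 0%E) ?adde0//.
apply/eqP; rewrite eq_le measure_ge0 andbT -(measure_msupportC mu).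
by apply: le_measure; rewrite ?inE// => x [_ nx] /sub.
Qed.

(** The blocks are finite and disjoint. An initial segment meets only finitely many of them, so
    removing it does not affect late blocks; and a long enough one contains any given finite number
    of blocks. *)
Lemma exhP (R : realType) (mu : nat -> {finite_measure set nat -> \bar R})
    (b : nat -> nat) (s : nat -> seq nat) (A : set nat) :
  (forall n, uniq (s n)) -> (forall n x, (x \in s n) = (b x == n)) ->
  (forall n, msupport (mu n) `<=` [set` s n]) ->
  exh (fun A => ereal_sup (range (fun n => mu n A))) A <->
  forall e : R, 0 < e -> exists N, forall n, (N <= n)%N -> (mu n A <= e%:E)%E.
Proof.
move=> us sb sub.
set phi := (fun A => ereal_sup (range (fun n => mu n A))).
have muE n X := measure_seq_sum X (us n) (sub n).
have phi0 X : (0 <= phi X)%E.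
  by apply: le_trans (measure_ge0 (mu 0%N) X) _; apply: ereal_sup_ubound; exists 0%N.
rewrite /exh /= -/phi; split=> [/fine_cvgP[fin /cvg0P cvg] e e0|H].
  have [N0 _ HN0] := fin; have [N1 HN1] := cvg e e0.
  pose m := maxn N0 N1.
  have phie : (phi (A `\` `I_m.+1) <= e%:E)%E.
    have fm : phi (A `\` `I_m.+1) \is a fin_num by apply: HN0; exact: leq_maxl.
    rewrite -(fineK fm) lee_fin; apply: le_trans (ler_norm _) _.
    by apply: HN1; exact: leq_maxr.
  (* The sum is a crude upper bound for the finitely many values [b x]. *)
  exists (\sum_(x < m.+1) b x).+1 => n Nn; apply: le_trans phie.
  apply: le_trans (_ : mu n (A `\` `I_m.+1) <= _)%E; last first.
    by apply: ereal_sup_ubound; exists n.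
  rewrite !muE lee_fin le_eqVlt; apply/orP; left; apply/eqP.
  rewrite big_seq_cond [RHS]big_seq_cond; apply: eq_bigl => x.
  have [|//] := boolP (x \in s n); rewrite sb => /eqP bx /=.
  rewrite in_setD (_ : x \in `I_m.+1 = false) ?andbT//.
  apply/negP; rewrite in_setE /= => xm; move: Nn.
  by rewrite -bx ltnNge (bigD1 (Ordinal xm))//= leq_addr.
apply/fine_cvgP.
have bnd e : 0 < e -> exists m, forall n, (m <= n)%N -> (phi (A `\` `I_n.+1) <= e%:E)%E.
  move=> e0; have [N HN] := H e e0.
  exists (\sum_(k < N) \sum_(x <- s k) x)%N => n mn.
  apply: ge_ereal_sup => _ [k _ <-]; have [Nk|kN] := leqP N k.
    by apply: le_trans (HN k Nk); apply: le_measure; rewrite ?inE// => x [].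
  rewrite muE lee_fin big_seq_cond big_pred0 ?ltW// => x.
  apply/negP => /andP[xs]; rewrite in_setE => -[_ /=]; apply; rewrite ltnS.
  apply: leq_trans mn; rewrite (bigD1 (Ordinal kN))//=.
  by apply: leq_trans (leq_addr _ _); rewrite (big_rem x)//= leq_addr.
split.
  have [m Hm] := bnd 1 ltr01; exists m => // n /= mn.
  by rewrite ge0_fin_numE//; apply: le_lt_trans (Hm n mn) _; rewrite ltry.
apply/cvg0P => e e0; have [m Hm] := bnd e e0; exists m => n mn /=.
have fm : phi (A `\` `I_n.+1) \is a fin_num.
  by rewrite ge0_fin_numE//; apply: le_lt_trans (Hm n mn) _; rewrite ltry.
by rewrite ger0_norm ?fine_ge0// -lee_fin fineK// Hm.
Qed.

(* Points outside all supports are thrown in with weights tending to [0].     *)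
Lemma density_ideal_blocks (R : realType) (I : set (set nat)) :
  density_ideal R I -> exists w b s,
    weighted_blocks w b s /\ I = block_ideal (w : nat -> R) s.
Proof.
move=> [phi [[mu [finS disjS ->]] -> _]].
(* The default [x] puts a point outside all supports into the block with its own number, so each
   block receives at most one such point. *)
pose b x := xget x [set n | msupport (mu n) x].
have bsupp n x : msupport (mu n) x -> b x = n.
  move=> nx; have bx : msupport (mu (b x)) x by exact: (@xgetI _ x [set n | msupport (mu n) x] n).
  by apply: disjS => //; exists x.
have bN x : (~ exists n, msupport (mu n) x) -> b x = x.
  by move=> nx; rewrite /b xgetPN// => n mx; apply: nx; exists n.
have finb n : finite_set [set x | b x = n].
  apply: (@sub_finite_set _ _ (msupport (mu n) `|` [set n])).
    move=> x /= bx; have [[m mx]|/bN] := pselect (exists n, msupport (mu n) x).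
      by left; rewrite -bx (bsupp _ _ mx).
    by right; rewrite -bx.
  by rewrite finite_setU; split; [exact: finS | exact: finite_set1].
have /choice[s0 Hs0] n : exists t : seq nat, [set x | b x = n] = [set` t].
  exact/finite_seqP.
pose s n := undup (s0 n).
have sb n x : (x \in s n) = (b x == n).
  rewrite mem_undup; have := Hs0 n => /seteqP[H1 H2].
  by apply/idP/eqP => [/H2|/H1].
have us n : uniq (s n) by exact: undup_uniq.
have sub n : msupport (mu n) `<=` [set` s n].
  by move=> x /bsupp bx /=; rewrite sb bx.
pose m n x : R := fine (mu n [set x]).
pose w x : R := if `[< exists n, msupport (mu n) x >] then m (b x) x else x.+1%:R^-1.
have m0 n x : 0 <= m n x by exact: fine_ge0.
have w0 x : 0 < w x.
  rewrite /w; case: asboolP => [[n nx]|_]; last by rewrite invr_gt0.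
  rewrite /m (bsupp _ _ nx) fine_gt0// lt0e measure_ge0 ltey_eq fin_num_measure//.
  by rewrite !andbT.
exists w, b, s; split=> //; apply/seteqP; split=> A; rewrite exhP//.
all: rewrite /block_ideal /= cvg0P => H.
  move=> e e0; have e2 : 0 < e / 2 by lra.
  have [N HN] := H _ e2.
  pose N' := Num.truncn (2 / e); exists (maxn N N') => n; rewrite geq_max => /andP[Nn N'n].
  rewrite ger0_norm; last by apply: block_sum_ge0 => x; exact: ltW.
  have := HN n Nn; rewrite (measure_seq_sum A (us n) (sub n)) lee_fin -/(m n) => Hm.
  apply: le_trans (_ : \sum_(x <- s n | x \in A) (m n x + (if x == n then n.+1%:R^-1 else 0)) <= _).
    rewrite /block_sum big_seq_cond [leRHS]big_seq_cond; apply: ler_sum => x.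
    rewrite sb => /andP[/eqP bx _]; rewrite /w; case: asboolP => [_|nx].
      by rewrite bx lerDl; case: ifP.
    by rewrite -bx (bN _ nx) eqxx lerDr.
  rewrite big_split /= [e]splitr lerD//.
  apply: le_trans (_ : \sum_(x <- s n) (if x == n then n.+1%:R^-1 else 0) <= _).
    rewrite big_mkcond; apply: ler_sum => x _; case: ifP => // _; by case: ifP.
  rewrite -big_mkcond -big_filter.
  have -> : \sum_(i <- [seq i <- s n | i == n]) n.+1%:R^-1 =
      (count (pred1 n) (s n))%:R * n.+1%:R^-1 :> R.
    by rewrite big_const_seq count_predT size_filter iter_addr_0 mulr_natl.
  rewrite count_uniq_mem//; apply: le_trans (_ : n.+1%:R^-1 <= _).
    by rewrite ler_piMl ?invr_ge0// lern1 leq_b1.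
  rewrite -[e / 2]invrK invf_div lef_pV2 ?posrE ?divr_gt0//.
  by apply: le_trans (ltW (truncnS_gt _)) _; rewrite ler_nat.
move=> e e0; have [N HN] := H e e0; exists N => n Nn.
rewrite (measure_seq_sum A (us n) (sub n)) lee_fin.
apply: le_trans (HN n Nn); apply: le_trans (ler_norm _).
rewrite /block_sum big_seq_cond [leRHS]big_seq_cond; apply: ler_sum => x.
rewrite sb => /andP[/eqP bx _]; rewrite /w; case: asboolP => [_|nx].
  by rewrite bx.
have -> : mu n [set x] = 0%E.
  by apply/eqP; apply: contrapT => /negP mx; apply: nx; exists n.
by rewrite invr_ge0.
Qed.

Lemma weighted_blocks_proper (R : realType) (w : nat -> R) b s N :
  weighted_blocks w b s -> exists K, forall x, (K <= x)%N -> (N <= b x)%N.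
Proof.
move=> [_ _ sb]; exists (\sum_(k < N) \sum_(x <- s k) x).+1%N => x Kx.
rewrite leqNgt; apply/negP => bN; move: Kx.
rewrite (bigD1 (Ordinal bN))//= ltnNge; apply/negP; rewrite negbK.
by apply: leq_trans (leq_addr _ _); rewrite (big_rem x) ?sb//= leq_addr.
Qed.

Lemma block_idealS (R : realType) (w : nat -> R) s A B :
  (forall x, 0 < w x) -> A `<=` B -> block_ideal w s B -> block_ideal w s A.
Proof.
move=> w0 AB; rewrite /block_ideal /= !cvg0P => H e e0.
have w0' x : 0 <= w x by exact: ltW.
have [N HN] := H e e0; exists N => n /HN; rewrite !ger0_norm ?block_sum_ge0//.
by apply: le_trans; exact: le_block_sum.
Qed.

Lemma block_idealU (R : realType) (w : nat -> R) s A B :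
  (forall x, 0 < w x) ->
  block_ideal w s A -> block_ideal w s B -> block_ideal w s (A `|` B).
Proof.
move=> w0 IA IB; have {}IB : block_ideal w s (B `\` A).
  by apply: block_idealS IB => // x [].
have -> : A `|` B = A `|` (B `\` A) by rewrite setDE setUIr setUv setIT.
rewrite /block_ideal /=; under eq_fun do rewrite block_sumU ?setDIK//.
by rewrite -[0]addr0; exact: cvgD.
Qed.

Lemma block_ideal_seq (R : realType) (w : nat -> R) b s (t : seq nat) :
  weighted_blocks w b s -> block_ideal w s [set` t].
Proof.
move=> [_ _ sb]; apply/cvg0P => e e0.
exists (\sum_(x <- t) b x).+1%N => n tn.
rewrite /block_sum big_seq_cond big_pred0 ?normr0 ?ltW// => x.
apply/negP => /andP[]; rewrite sb in_setE /= => /eqP bx xt.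
by move: tn; rewrite (big_rem x)//= bx ltnNge leq_addr.
Qed.

(* Correcting [W n] by a multiple of the two-valued measure of the dual       *)
(* filter makes a sequence converging to [0] on [I] converge on all of the    *)
(* algebra.                                                                   *)
Lemma nikodym_ideal_bounded (R : realType) (I : set (set nat))
    (W : nat -> set nat -> R) :
  (forall A B, A `<=` B -> I B -> I A) ->
  (forall A B, I A -> I B -> I (A `|` B)) -> ~ I setT ->
  nikodym R (I `|` dual_filter I) ->
  (forall n X Y, X `&` Y = set0 -> W n (X `|` Y) = W n X + W n Y) ->
  (forall n X, 0 <= W n X) ->
  (forall X, I X -> W n X @[n --> \oo] --> 0) ->
  exists M, forall n X, I X -> W n X <= M.
Proof.
move=> IS IU IT nik addW W0 cW.
have IC A : I A -> ~ I (~` A) by move=> IA IcA; apply: IT; rewrite -(setUv A); exact: IU.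
pose nu n X := W n X - (if `[< I X >] then 0 else W n setT).
have nuI n X : I X -> nu n X = W n X by move=> IX; rewrite /nu asboolT// subr0.
have nuC n X : I X -> nu n (~` X) = - W n X.
  move=> IX; rewrite /nu asboolF; last exact: IC.
  by rewrite -(setUv X) addW ?setICr//; lra.
have WT n X : W n X <= W n setT.
  by rewrite -(setUv X) addW ?setICr// lerDl.
have addm n X Y : I X -> I Y -> X `&` ~` Y = set0 ->
    nu n (X `|` ~` Y) = nu n X + nu n (~` Y).
  move=> IX IY XY; have XsY : X `<=` Y.
    move=> x Xx; apply: contrapT => nYx.
    by have : (X `&` ~` Y) x by []; rewrite XY.
  have -> : X `|` ~` Y = ~` (Y `\` X) by rewrite setCD setUC.
  rewrite nuC; last by apply: IS IY => x [].
  rewrite nuI// nuC// -[in RHS](setDUK XsY) addW ?setDIK//; lra.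
have [||X [IX|[X' IX <-]]|M HM] := nik nu.
- move=> n ? ? [IX|[X IX <-]] [IY|[Y IY <-]] XY.
  + by rewrite !nuI ?addW//; exact: IU.
  + exact: addm.
  + by rewrite setUC addrC addm// setIC.
  + exfalso; apply: (IC X IX); apply: IS IY => x nXx; apply: contrapT => nYx.
    by have : (~` X `&` ~` Y) x by []; rewrite XY.
- move=> n; exists (W n setT) => ? [IX|[X IX <-]]; first by rewrite nuI// ger0_norm.
  by rewrite nuC// normrN ger0_norm.
- by under eq_fun do rewrite nuI//; exact: cW.
- under eq_fun do rewrite nuC//.
  by rewrite -oppr0; apply: cvgN; exact: cW.
exists M => n X IX; rewrite -lee_fin; apply: le_trans (HM n).
apply: ereal_sup_ge; exists (`|nu n X| + `|nu n set0|)%:E.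
  exists X, set0; split=> //; [by left|left|by rewrite setI0].
  exact: IS IX.
by rewrite lee_fin nuI// ger0_norm// lerDl.
Qed.

(** A block is finite, hence in the ideal; the uniform bound on the block sums, taken at the block
    itself, bounds its mass. *)
Lemma nikodym_blocks_bounded (R : realType) (w : nat -> R) b s :
  let I := block_ideal w s in
  weighted_blocks w b s -> ~ I setT -> nikodym R (I `|` dual_filter I) ->
  exists M, forall n, block_sum w (s n) setT <= M.
Proof.
move=> I wb IT nik; have [w0 us sb] := wb.
have w0' x : 0 <= w x by exact: ltW.
have [||n X Y XY|n X|X IX|M HM] :=
    @nikodym_ideal_bounded R I (fun n => block_sum w (s n)) _ _ IT nik.
- by move=> A B AB; exact: block_idealS.
- by move=> A B; exact: block_idealU.
- exact: block_sumU.
- exact: block_sum_ge0.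
- exact: IX.
exists M => n; have := HM n _ (block_ideal_seq (s n) wb); apply: le_trans.
rewrite /block_sum big_seq_cond [leRHS]big_seq_cond le_eqVlt; apply/orP; left.
by apply/eqP/eq_bigl => x; rewrite in_setT andbT; case xs: (x \in s n) => //=; rewrite mem_set.
Qed.

(** Put mass [n] at each point [n] of weight above [e]. A set in the ideal contains only finitely
    many such points, so these point masses tend to 0 on it; their uniform bound, taken at
    singletons, bounds the heavy points. *)
Lemma nikodym_weights_cvg0 (R : realType) (w : nat -> R) b s (e : R) :
  let I := block_ideal w s in
  weighted_blocks w b s -> ~ I setT -> nikodym R (I `|` dual_filter I) ->
  0 < e -> exists N, forall x, (N <= x)%N -> w x <= e.
Proof.
move=> I wb IT nik e0; have [w0 us sb] := wb.
have w0' x : 0 <= w x by exact: ltW.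
pose W n (X : set nat) : R := if (e < w n) && (n \in X) then n%:R else 0.
have [||n X Y XY|n X|X IX|M HM] := @nikodym_ideal_bounded R I W _ _ IT nik.
- by move=> A B AB; exact: block_idealS.
- by move=> A B; exact: block_idealU.
- rewrite /W in_setU; case: (e < w n) => /=; last by rewrite addr0.
  case: (boolP (n \in X)) => nX; case: (boolP (n \in Y)) => nY; rewrite ?addr0 ?add0r//.
  have : (X `&` Y) n by split; exact/set_mem.
  by rewrite XY.
- by rewrite /W; case: ifP.
- apply/cvg0P => d d0; have [N HN] := (cvg0P _).1 IX e e0.
  have [K HK] := weighted_blocks_proper N wb.
  exists K => n Kn; rewrite /W ifF ?normr0 ?ltW//; apply/negP => /andP[ewn nX].
  have := HN (b n) (HK n Kn); rewrite ger0_norm ?block_sum_ge0// leNgt.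
  apply/negP; rewrite negbK; apply: lt_le_trans ewn _.
  by rewrite /block_sum (big_rem n) ?sb//= nX lerDl sumr_ge0.
exists (Num.truncn M).+1 => x Mx; rewrite leNgt; apply/negP => ewx.
have Ix : I [set x].
  have -> : [set x] = [set` [:: x]]; last exact: block_ideal_seq.
  by apply/seteqP; split=> y /=; rewrite inE => /eqP.
have := HM x _ Ix; rewrite /W ewx mem_set//= leNgt.
by rewrite (lt_le_trans (truncnS_gt _))// ler_nat.
Qed.

(** * From blocks to an Erdos-Ulam function *)

(** Big and small indices are numbered separately; equal rank is what pairs a small block with a big
    one. *)
Definition class_rank (big : pred nat) (n : nat) : nat :=
  count (fun m => big m == big n) (iota 0 n).

Lemma class_rank_le big n : (class_rank big n <= n)%N.
Proof. by apply: leq_trans (count_size _ _) _; rewrite size_iota. Qed.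

Lemma class_rank_inj big m n :
  big m = big n -> class_rank big m = class_rank big n -> m = n.
Proof.
have lt k l : (k < l)%N -> big k = big l -> (class_rank big k < class_rank big l)%N.
  move=> kl bkl; have E : iota 0 l = iota 0 k ++ k :: iota k.+1 (l - k.+1).
    by rewrite -[_ :: _]/(iota (0 + k) (l - k.+1).+1) -iotaD -subSn// subSS subnKC// ltnW.
  by rewrite /class_rank E count_cat /= bkl eqxx addnA addn1 ltnS leq_addr.
move=> bmn rmn; case: (ltngtP m n) => // /lt; rewrite bmn rmn ltnn.
  by move=> /(_ erefl).
by move=> /(_ erefl).
Qed.

Lemma class_rank_surj (big : pred nat) j :
  (forall N, exists2 n, (N <= n)%N & big n) ->
  exists2 n, big n & class_rank big n = j.
Proof.
move=> inf; pose c n := count big (iota 0 n).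
have cS n : c n.+1 = (c n + big n)%N by rewrite /c -addn1 iotaD count_cat /= addn0.
have cmono m n : (m <= n)%N -> (c m <= c n)%N.
  by move=> mn; rewrite /c -(subnKC mn) iotaD count_cat leq_addr.
have unb i : exists n, (i < c n)%N.
  elim: i => [|i [N HN]].
    by have [n _ bn] := inf 0%N; exists n.+1; rewrite cS bn addn1.
  have [n Nn bn] := inf N; exists n.+1; rewrite cS bn addn1 ltnS.
  exact: leq_trans HN (cmono _ _ Nn).
case: (ex_minnP (unb j)) => -[//|n] jn minn.
have cn : (c n <= j)%N by rewrite leqNgt; apply/negP => /minn; rewrite ltnn.
move: jn; rewrite cS; case bn: (big n); last by rewrite addn0 ltnNge cn.
rewrite addn1 ltnS => jn; exists n => //.
rewrite /class_rank; under eq_count do rewrite bn eqb_id.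
by apply/eqP; rewrite eqn_leq; apply/andP.
Qed.

(* Each big block absorbs at most one small block. *)
Lemma merge_blocks (R : realType) (w : nat -> R) b s (M : R) :
  weighted_blocks w b s -> ~ block_ideal w s setT ->
  (forall n, block_sum w (s n) setT <= M) ->
  exists b' s' c, [/\ weighted_blocks w b' s', block_ideal w s = block_ideal w s',
    0 < c & forall j, c <= block_sum w (s' j) setT <= M + M].
Proof.
move=> wb IT HM; have [w0 us sb] := wb; have w0' x : 0 <= w x by exact: ltW.
(* Otherwise the masses would tend to 0 and [setT] would be in the ideal. *)
have [c c0 inf] : exists2 c, 0 < c &
    forall N, exists2 n, (N <= n)%N & c < block_sum w (s n) setT.
  apply: contrapT => H; apply: IT; apply/cvg0P => e e0; apply: contrapT => nex.
  apply: H; exists e => // N; apply: contrapT => nn; apply: nex; exists N => n Nn.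
  rewrite ger0_norm ?block_sum_ge0// leNgt; apply/negP => lt; apply: nn.
  by exists n.
pose big n := c < block_sum w (s n) setT.
pose rk := class_rank big.
(* In the merged block [t], [nm.1] numbers the big constituent and [nm.2] the small one; if no small
   block has rank [j], both are the big one. *)
have group j : exists t (nm : nat * nat), [/\ uniq t, forall x, (x \in t) = (rk (b x) == j),
    [/\ big nm.1, rk nm.1 = j & rk nm.2 = j],
    forall k, rk k = j -> k = nm.1 \/ k = nm.2 &
    forall A, [/\ block_sum w (s nm.1) A <= block_sum w t A,
      block_sum w (s nm.2) A <= block_sum w t A &
      block_sum w t A <= block_sum w (s nm.1) A + block_sum w (s nm.2) A]].
  have [n bn rn] := class_rank_surj j inf.
  have uni k l : rk k = j -> rk l = j -> big k = big l -> k = l.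
    by move=> rkj rlj kl; apply: (class_rank_inj kl); rewrite -/rk rkj rlj.
  have [[m bm rm]|nm] := pselect (exists2 m, ~~ big m & rk m = j); last first.
    exists (s n), (n, n).
    have uni' k : rk k = j -> k = n.
      move=> rkj; apply: uni => //; rewrite [RHS]bn; apply: contrapT => /negP bk.
      by apply: nm; exists k.
    split=> //.
    - by move=> x; rewrite sb; apply/eqP/eqP => [->//|/uni'].
    - by move=> k /uni' ->; left.
    - by move=> A; split=> //; rewrite lerDl block_sum_ge0.
  have uni' k : rk k = j -> k = n \/ k = m.
    move=> rkj; have [bk|bk] := boolP (big k).
      by left; apply: uni => //; rewrite [RHS]bn.
    by right; apply: uni => //; rewrite (negbTE bk) (negbTE bm).
  exists (s n ++ s m), (n, m); split=> //=.
  - rewrite cat_uniq !us /= andbT; apply/hasPn => x; rewrite !sb => /eqP ->.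
    by apply/eqP => mn; move: bm; rewrite mn => /negP; apply.
  - move=> x; rewrite mem_cat !sb; apply/orP/eqP => [[] /eqP -> //|/uni' []->].
      by left.
    by right.
  - by move=> A; rewrite /block_sum big_cat/=; split; rewrite ?lerDl ?lerDr// sumr_ge0.
have [s' Hs'] := choice group; have [nm Hnm] := choice Hs'.
exists (rk \o b), s', c; split=> //.
- split=> // j.
    by have [] := Hnm j.
  by move=> x; have [_ ->] := Hnm j.
- apply/seteqP; split=> A; rewrite /block_ideal /= !cvg0P => H e e0.
    have e2 : 0 < e / 2 by lra.
    have [N HN] := H _ e2; exists N => j Nj.
    have [_ _ [_ r1 r2] _ /(_ A)[_ _]] := Hnm j.
    rewrite ger0_norm ?block_sum_ge0//; move/le_trans; apply.
    have rN k : rk k = j -> (N <= k)%N.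
      by move=> rkj; apply: leq_trans Nj _; rewrite -rkj class_rank_le.
    by rewrite [e]splitr lerD//; apply: le_trans (ler_norm _) (HN _ (rN _ _)).
  have [N HN] := H e e0.
  exists (\sum_(j < N) ((nm j).1 + (nm j).2)).+1%N => k Kk.
  have rkN : (N <= rk k)%N.
    rewrite leqNgt; apply/negP => kN; move: Kk.
    rewrite (bigD1 (Ordinal kN))//= ltnNge; apply/negP; rewrite negbK.
    apply: leq_trans (leq_addr _ _).
    have [_ _ _ /(_ k erefl) + _] := Hnm (rk k).
    by case=> {1}->; rewrite ?leq_addl ?leq_addr.
  have := HN _ rkN; rewrite !ger0_norm ?block_sum_ge0//; apply: le_trans.
  have [_ _ _ /(_ k erefl) kE /(_ A)[H1 H2 _]] := Hnm (rk k).
  by case: kE => {1}->.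
- move=> j; have [_ _ [bn _ _] _ /(_ setT)[H1 _ H2]] := Hnm j.
  apply/andP; split; first by apply: le_trans H1; exact: ltW.
  by apply: le_trans H2 _; rewrite lerD.
Qed.

Lemma sum_pow2 (R : realType) m : \sum_(i < m) 2 ^+ i = 2 ^+ m - 1 :> R.
Proof.
elim: m => [|m IH]; first by rewrite big_ord0 expr0 subrr.
by rewrite big_ord_recr /= IH exprS; lra.
Qed.

(** The terms before [J] contribute less than [2 ^+ J], the later ones at most [d] times a geometric
    sum. *)
Lemma sum_pow2_small (R : realType) (r : nat -> R) J d m :
  (forall i, 0 <= r i <= 1) -> (forall i, (J <= i)%N -> r i <= d) -> 0 <= d ->
  \sum_(i < m) 2 ^+ i * r i <= 2 ^+ J + d * 2 ^+ m.
Proof.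
move=> r01 rd d0.
have p0 k : 0 <= 2 ^+ k :> R by rewrite exprn_ge0.
have small k : \sum_(i < k) 2 ^+ i * r i <= 2 ^+ k.
  apply: le_trans (_ : \sum_(i < k) 2 ^+ i <= _); last by rewrite sum_pow2; lra.
  by apply: ler_sum => i _; rewrite ler_piMr//; case/andP: (r01 i).
elim: m => [|m IH].
  by rewrite big_ord0 addr_ge0// mulr_ge0.
have [mJ|Jm] := leqP m.+1 J.
  apply: le_trans (small _) _; apply: le_trans (_ : 2 ^+ J <= _).
    by rewrite ler_weXn2l// ler1n.
  by rewrite lerDl mulr_ge0.
rewrite big_ord_recr /=; have : 2 ^+ m * r m <= 2 ^+ m * d by rewrite ler_wpM2l// rd.
by rewrite [2 ^+ m.+1]exprS; lra.
Qed.

(* Concatenating the blocks enumerates [nat] block after block. *)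
Lemma block_enumeration (R : realType) (w : nat -> R) b s :
  weighted_blocks w b s -> (forall j, s j != [::]) ->
  exists (e h : nat -> nat) (L : nat -> nat),
    [/\ cancel e h, cancel h e, forall j, (j <= L j)%N,
      forall n j, (b (e n) < j)%N = (n < L j)%N &
      forall (F : nat -> R) (A : set nat) j,
        \sum_(0 <= i < L j | e i \in A) F (e i) = \sum_(i < j) block_sum F (s i) A].
Proof.
move=> [_ us sb] s0.
pose C j := flatten [seq s i | i <- iota 0 j].
have CS j : C j.+1 = C j ++ s j.
  by rewrite /C -addn1 iotaD map_cat flatten_cat /= cats0.
have Cmem j x : (x \in C j) = (b x < j)%N.
  by elim: j => [//|j IH]; rewrite CS mem_cat IH sb orbC ltnS [RHS]leq_eqVlt.
have Cuniq j : uniq (C j).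
  elim: j => [//|j IH]; rewrite CS cat_uniq IH us andbT /=; apply/hasPn => x.
  by rewrite sb Cmem => /eqP ->; rewrite ltnn.
pose L j := size (C j).
have Lge j : (j <= L j)%N.
  elim: j => // j IH; rewrite /L CS size_cat -addn1 leq_add// lt0n size_eq0.
  exact: s0.
have Cpre j k : (j <= k)%N -> exists t, C k = C j ++ t.
  elim: k => [|k IH]; first by rewrite leqn0 => /eqP ->; exists [::]; rewrite cats0.
  rewrite leq_eqVlt => /predU1P[<-|/IH[t Et]]; first by exists [::]; rewrite cats0.
  by exists (t ++ s k); rewrite CS Et catA.
(* As no block is empty, [C n.+1] has more than [n] entries, and longer concatenations only extend
   it. *)
pose e n := nth 0%N (C n.+1) n.
have eE n j : (n < L j)%N -> e n = nth 0%N (C j) n.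
  move=> nj; have nn : (n < L n.+1)%N by exact: Lge.
  have [/Cpre[t Et]|/ltnW/Cpre[t Et]] := leqP n.+1 j.
    by rewrite Et nth_cat nn.
  by rewrite /e Et nth_cat nj.
pose h x := index x (C (b x).+1).
have hlt x : (h x < L (b x).+1)%N by rewrite index_mem Cmem.
have hK : cancel h e by move=> x; rewrite (eE _ _ (hlt x)) nth_index// Cmem.
have einj : injective e.
  move=> m n; pose k := (maxn m n).+1.
  have mk : (m < L k)%N by apply: leq_trans (Lge k); rewrite ltnS leq_maxl.
  have nk : (n < L k)%N by apply: leq_trans (Lge k); rewrite ltnS leq_maxr.
  by rewrite (eE _ _ mk) (eE _ _ nk) => /eqP; rewrite nth_uniq// => /eqP.
have eK : cancel e h by move=> n; apply: einj; rewrite hK.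
exists e, h, L; split=> //.
  move=> n j; apply/idP/idP => [bj|nj]; last first.
    by rewrite -Cmem (eE _ _ nj) mem_nth.
  have inC : e n \in C j by rewrite Cmem.
  have ij : (index (e n) (C j) < L j)%N by rewrite index_mem.
  by have := eE _ _ ij; rewrite nth_index// => /einj nE; rewrite nE in ij.
move=> F A j; transitivity (\sum_(x <- C j | x \in A) F x).
  rewrite [RHS](big_nth 0%N); apply: congr_big_nat => // i.
    by move=> /andP[_ ij]; rewrite (eE _ _ ij).
  by move=> /andP[_ /andP[_ ij]]; rewrite (eE _ _ ij).
by rewrite /C big_flatten big_map -{1}[j]subn0 big_mkord.
Qed.

(** With mass [2 ^+ j] on block [j], each block is comparable to all preceding ones together, so the
    density quotient is controlled by the proportions that a set fills in late blocks. As the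
    original masses lie between [c] and [M], these proportions tend to 0 iff the block sums do. *)
Lemma blocks_erdos_ulam (R : realType) (w : nat -> R) b s (c M : R) :
  weighted_blocks w b s -> 0 < c ->
  (forall j, c <= block_sum w (s j) setT <= M) ->
  (forall e, 0 < e -> exists N, forall x, (N <= x)%N -> w x <= e) ->
  exists2 f : nat -> R, erdos_ulam_fun f &
    ideal_isomorphic (block_ideal w s) (erdos_ulam_ideal f).
Proof.
move=> wb c0 cM wcvg; have [w0 us sb] := wb; have w0' x : 0 <= w x by exact: ltW.
pose T j := block_sum w (s j) setT.
have Tc j : c <= T j by case/andP: (cM j).
have TM j : T j <= M by case/andP: (cM j).
have T0 j : 0 < T j by exact: lt_le_trans (Tc j).
have M0 : 0 < M by exact: lt_le_trans (TM 0%N).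
have s0 j : s j != [::].
  by apply/eqP => sj; have := T0 j; rewrite /T sj /block_sum big_nil ltxx.
have [e [h [L [eK hK Lge bL sumL]]]] := block_enumeration wb s0.
pose F x := 2 ^+ b x * w x / T (b x).
pose f n := F (e n).
have p0 k : 0 < 2 ^+ k :> R by rewrite exprn_gt0.
have F0 x : 0 < F x by rewrite divr_gt0// mulr_gt0.
have f0 n : 0 < f n by exact: F0.
have f0' n : 0 <= f n by exact: ltW.
have FE i A : block_sum F (s i) A = 2 ^+ i * (block_sum w (s i) A / T i).
  rewrite /block_sum big_seq_cond mulrA mulr_sumr mulr_suml [RHS]big_seq_cond.
  by apply: eq_bigr => x; rewrite sb /F => /andP[/eqP ->].
pose S n := \sum_(0 <= i < n) f i.
have SL j : S (L j) = 2 ^+ j - 1.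
  rewrite /S -partial_sumT -sum_pow2.
  rewrite /partial_sum (eq_bigl (fun i => e i \in [set: nat])); last first.
    by move=> i; rewrite !in_setT.
  rewrite sumL; apply: eq_bigr => i _; rewrite FE divff ?mulr1//.
  exact: lt0r_neq0 (T0 i).
have Sge n : 2 ^+ b (e n) - 1 <= S n.
  by rewrite -SL; apply: le_partial_sum_total => //; rewrite leqNgt -bL ltnn.
have Sge2 n : (L 1 <= n)%N -> 2 ^+ b (e n) <= 2 * S n.
  rewrite leqNgt -bL -leqNgt => b1; have := Sge n.
  have : 2 ^+ 1 <= 2 ^+ b (e n) :> R by rewrite ler_weXn2l// ler1n.
  by rewrite expr1; lra.
have hE A : h @` A = e @^-1` A.
  apply/seteqP; split=> [_ [x Ax <-]|n en]; first by rewrite /= hK.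
  by exists (e n).
have sumA A j : partial_sum f (h @` A) (L j) =
    \sum_(i < j) 2 ^+ i * (block_sum w (s i) A / T i).
  rewrite hE; transitivity (\sum_(i < j) block_sum F (s i) A).
    by rewrite -sumL; apply: eq_bigl => i; apply/idP/idP => /set_mem /mem_set.
  by apply: eq_bigr => i _; exact: FE.
have r01 A i : 0 <= block_sum w (s i) A / T i <= 1.
  apply/andP; split; first by rewrite divr_ge0 ?block_sum_ge0// ltW.
  by rewrite ler_pdivrMr// mul1r; exact: le_block_sum.
exists f.
  split=> //.
    apply/cvgryPge => C; exists (L (Num.truncn C).+1) => // n /= Ln.
    apply: le_trans (_ : S (L (Num.truncn C).+1) <= _); last exact: le_partial_sum_total.
    apply: le_trans (ltW (truncnS_gt _)) _; rewrite SL lerBrDr natr1 -natrX ler_nat.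
    exact: ltn_expl.
  apply/cvg0P => d d0.
  have [K HK] : exists K, forall x, (K <= x)%N -> w x <= d * c / 2.
    by apply: wcvg; rewrite !mulr_gt0// invr_gt0.
  exists (maxn (L 1) (\sum_(x < K) h x).+1) => n; rewrite geq_max => /andP[L1 Kn].
  have enK : (K <= e n)%N.
    rewrite leqNgt; apply/negP => enK; move: Kn.
    by rewrite (bigD1 (Ordinal enK))//= eK ltnNge leq_addr.
  have Spos : 0 < \sum_(0 <= i < n.+1) f i by exact: partial_sum_total_gt0.
  rewrite ger0_norm; last by apply: divr_ge0; exact: ltW.
  rewrite ler_pdivrMr//.
  have fle : f n <= 2 ^+ b (e n) * w (e n) / c.
    by rewrite /f /F ler_pM2l ?mulr_gt0// lef_pV2 ?posrE.
  apply: le_trans fle _; rewrite ler_pdivrMr//.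
  have SS : S n <= \sum_(0 <= i < n.+1) f i by exact: le_partial_sum_total.
  apply: le_trans (_ : 2 ^+ b (e n) * (d * c / 2) <= _).
    by rewrite ler_pM2l// HK.
  apply: le_trans (_ : 2 * S n * (d * c / 2) <= _).
    by rewrite ler_wpM2r ?Sge2// !mulr_ge0// ?invr_ge0// ltW.
  have : d * c * S n <= d * c * \sum_(0 <= i < n.+1) f i.
    by rewrite ler_wpM2l// mulr_ge0// ltW.
  move: (\sum_(0 <= i < n.+1) f i) => z; lra.
exists h; first by exists e.
move=> A; rewrite erdos_ulam_idealP// /block_ideal /= cvg0P; split=> H d d0.
  (* With [j] the block of position [n] and proportions at most [d / 8] from [J] on, the blocks up
     to [j] contribute at most [2 ^+ J + d / 4 * 2 ^+ j]. For large [j] this is at most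
     [d / 2 * 2 ^+ j], hence at most [d * S n]. *)
  have [J HJ] := H _ (mulr_gt0 (divr_gt0 d0 (ltr0Sn _ 7)) c0).
  have rJ i : (J <= i)%N -> block_sum w (s i) A / T i <= d / 8.
    move=> /HJ; rewrite ger0_norm ?block_sum_ge0// => /le_trans le.
    by rewrite ler_pdivrMr//; apply: le; rewrite ler_pM2l// divr_gt0.
  pose K := (J + (Num.truncn (4 / d)).+1)%N.
  exists (maxn (L 1) (L K)) => n; rewrite geq_max => /andP[L1 Kn].
  have Kj : (K <= b (e n))%N by rewrite leqNgt bL -leqNgt.
  pose j := b (e n); rewrite -/j in Kj.
  have nj : (n <= L j.+1)%N by apply: ltnW; rewrite -bL.
  apply: le_trans (_ : partial_sum f (h @` A) (L j.+1) <= _).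
    by rewrite /partial_sum big_mkcond [leRHS]big_mkcond le_partial_sum_total// => i; case: ifP.
  rewrite sumA; apply: le_trans (sum_pow2_small _ (r01 A) rJ _) _; first by lra.
  have SS := Sge2 n L1; rewrite -/j in SS.
  have big : 2 ^+ J * 4 <= 2 ^+ j * d :> R.
    rewrite -ler_pdivrMr// -mulrA.
    apply: le_trans (_ : 2 ^+ K <= _); last by rewrite ler_weXn2l// ler1n.
    rewrite /K exprD ler_pM2l//; apply: le_trans (ltW (truncnS_gt _)) _.
    by rewrite -natrX ler_nat ltnW// ltn_expl.
  have dS : 2 ^+ j * d <= 2 * S n * d by rewrite ler_pM2r.
  by rewrite exprS -/(S n); lra.
(* At the end of block [j] the total is below [2 ^+ j.+1], so block [j] alone, contributing
   [2 ^+ j * r], gives [r <= d / M] and a block sum of at most [d]. *)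
have d2 : 0 < d / (2 * M) by rewrite divr_gt0// mulr_gt0.
have [N HN] := H _ d2; exists N => j Nj.
rewrite ger0_norm ?block_sum_ge0//.
have NL : (N <= L j.+1)%N by apply: leq_trans (Lge _); exact: leqW.
have := HN _ NL; rewrite sumA -/(S _) SL big_ord_recr /=.
set r := block_sum w (s j) A / T j.
have sum0 : 0 <= \sum_(i < j) 2 ^+ i * (block_sum w (s i) A / T i).
  apply: sumr_ge0 => i _; apply: mulr_ge0; first exact: ltW.
  by case/andP: (r01 A i).
move=> le; have rle : r <= d / M.
  rewrite -(ler_pM2l (p0 j)); apply: le_trans (_ : d / (2 * M) * (2 ^+ j.+1 - 1) <= _).
    by apply: le_trans le; rewrite lerDr.
  apply: le_trans (_ : d / (2 * M) * 2 ^+ j.+1 <= _).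
    by rewrite ler_pM2l//; lra.
  by rewrite exprS invfM; lra.
have -> : block_sum w (s j) A = r * T j by rewrite /r mulfVK// gt_eqF.
apply: le_trans (_ : d / M * T j <= _); first by rewrite ler_pM2r.
by rewrite mulrAC ler_pdivrMr// ler_pM2l.
Qed.

Theorem theorem5p19 (R : realType) (I : set (set nat))
    (densI : density_ideal R I) :
  nikodym R (I `|` dual_filter I) <->
  exists2 f : nat -> R, erdos_ulam_fun f & ideal_isomorphic I (erdos_ulam_ideal f).
Proof.
split=> [nik|[f EUf iso]]; last first.
  exact: ideal_isomorphic_nikodym iso (erdos_ulam_nikodym EUf).
have [w [b [s [wb IE]]]] := density_ideal_blocks densI.
have [_ [_ _ IT]] := densI; rewrite {I densI}IE in nik IT *.
have [M HM] := nikodym_blocks_bounded wb IT nik.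
have [b' [s' [c [wb' -> c0 cM]]]] := merge_blocks wb IT HM.
(* Merging has changed the blocks but not the point weights, which still tend to 0. *)
apply: (blocks_erdos_ulam wb' c0 cM) => e; exact: nikodym_weights_cvg0 wb IT nik.
Qed.
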